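(* Let $V$ be a Gödel set with non-empty perfect kernel $P$, and let $W=V\cup[\inf P,1]$. Then for every set of formulas $\Gamma$ and formula $A$, $\Gamma\models_V A$ if and only if $\Gamma\models_W A$. Consequently $\mathbf{G}_V=\mathbf{G}_W$.
   Context: Fix a standard first-order language with connectives $\wedge,\vee,\rightarrow$, constant $\bot$, quantifiers $\forall,\exists$. A Gödel set is a closed $V\subseteq[0,1]$ with $0,1\in V$. A $V$-interpretation $\mathfrak I$ has a nonempty universe $U$, assigns to each $k$-ary predicate symbol a function $U^k\to V$, to each $k$-ary function symbol a function $U^k\to U$, and to each variable an element of $U$; truth values are: atomic formulas get the value of the predicate function on the term values, $\bot\mapsto 0$, $\wedge\mapsto\min$, $\vee\mapsto\max$, $\mathfrak I(A\rightarrow B)=1$ if $\mathfrak I(A)\le\mathfrak I(B)$ and $\mathfrak I(B)$ otherwise, $\forall\mapsto\inf$ and $\exists\mapsto\sup$ of the values of the instances $A(u)$, $u\in U$. $\Gamma\models_V A$ means: for every $V$-interpretation $\mathfrak I$, $\inf\{\mathfrak I(B):B\in\Gamma\}\le\mathfrak I(A)$. $\mathbf{G}_V$ is the set of formulas $A$ with $\mathfrak I(A)=1$ for all $V$-interpretations. By the Cantor–Bendixson theorem, $V=P\cup C$ uniquely with $P$ perfect (closed, no isolated points) and $C$ countable and open in $V$; $P$ is the perfect kernel of $V$.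
   Formalization: The first-order language is assumed to have at most countably many predicate and function symbols; for uncountable languages the entailment equivalence can fail (e.g. V the Cantor set, W=[0,1], with a constant for every real number). *)

(* Defs.v *)
From HB Require Import structures.
From mathcomp Require Import all_boot all_order all_algebra.
From mathcomp Require Import all_classical all_reals all_analysis.

Set Implicit Arguments.
Unset Strict Implicit.
Unset Printing Implicit Defensive.

Import Order.TTheory GRing.Theory Num.Theory.
Import numFieldNormedType.Exports.

Local Open Scope classical_set_scope.
Local Open Scope ring_scope.

(* As usual for first-order Goedel logics, a standard first-order language has
   at most countably many predicate and function symbols; countability matters,
   as passing from one Goedel set to another relies on countable models.
   Constants are function symbols of arity 0, and the variables are the natural
   numbers. *)
Record language := Language {
  psym : countType;
  par : psym -> nat;
  fsym : countType;
  far : fsym -> nat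
}.

Inductive term (L : language) : Type :=
| Var of nat
| App (f : fsym L) of ('I_(far f) -> term L).

Inductive formula (L : language) : Type :=
| Bot
| Atom (p : psym L) of ('I_(par p) -> term L)
| And of formula L & formula L
| Or of formula L & formula L
| Imp of formula L & formula L
| All of nat & formula L
| Ex of nat & formula L.

Definition godel_set (R : realType) (V : set R) : Prop :=
  [/\ closed V, V `<=` `[0, 1], V 0 & V 1].

(* The universe is nonempty because it contains the values of the variables. *)
Record interp (R : realType) (L : language) (V : set R) := Interp {
  univ : Type;
  pval : forall p : psym L, ('I_(par p) -> univ) -> R;
  pvalP : forall (p : psym L) (u : 'I_(par p) -> univ), V (pval u);
  fval : forall f : fsym L, ('I_(far f) -> univ) -> univ;
  vval : nat -> univ
}.

Section Semantics.
Variables (R : realType) (L : language) (V : set R) (I : interp L V).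
Implicit Types e : nat -> univ I.

Fixpoint teval e (t : term L) : univ I :=
  match t with
  | Var x => e x
  | App f ts => fval (fun i => teval e (ts i))
  end.

(* The instance A(u) of a quantified formula is evaluated by sending the bound
   variable to u. *)
Fixpoint feval e (A : formula L) : R :=
  match A with
  | Bot => 0
  | Atom p ts => pval (fun i => teval e (ts i))
  | And B C => Num.min (feval e B) (feval e C)
  | Or B C => Num.max (feval e B) (feval e C)
  | Imp B C => if feval e B <= feval e C then 1 else feval e C
  | All x B => inf (range (fun u : univ I => feval [eta e with x |-> u] B))
  | Ex x B => sup (range (fun u : univ I => feval [eta e with x |-> u] B))
  end.

Definition truth (A : formula L) : R := feval (@vval R L V I) A.

(* The infimum is taken in [0, 1], so that it is 1 for the empty set, whereas
   the library has inf set0 = 0. Adjoining 1 changes no other infimum. *)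
Definition truth_set (G : set (formula L)) : R := inf ([set 1] `|` (truth @` G)).

End Semantics.

Definition entails (R : realType) (L : language) (V : set R)
    (G : set (formula L)) (A : formula L) : Prop :=
  forall I : interp L V, truth_set I G <= truth I A.

Definition godel_logic (R : realType) (L : language) (V : set R) :
    set (formula L) :=
  [set A | forall I : interp L V, truth I A = 1].
Arguments godel_logic {R} L V.

(* By the Cantor-Bendixson theorem, a closed V has exactly one perfect kernel.
   The library's perfect_set, like the textbook notion, admits the empty
   set. *)
Definition perfect_kernel (R : realType) (V P : set R) : Prop :=
  perfect_set P /\
  exists C : set R,
    [/\ countable C, exists2 O : set R, open O & C = V `&` O & V = P `|` C].

(* Main.v *)
(* Entailment passes from W to V because V is a subset of W. Conversely, a
   W-interpretation refuting an entailment may be taken with a countable set M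
   of truth values, by a Skolem hull argument. Then some nondecreasing f maps W
   into V, fixes 0 and 1, separates the values on both sides of the gap between
   the premises and the conclusion, collapses two values only when it sends both
   to 1, and is continuous at every point of M; hence f commutes with all
   connectives and quantifiers, and composing the predicates with f gives a
   V-interpretation refuting the same entailment.

   To build f, embed [0, 1] strictly monotonically into P by a dyadic scheme
   (between two points of P separated by a third there is room for a midpoint).
   The embedding has only countably many jumps, so that a suitable affine
   reparametrization moves all of them away from M. *)

Require Import Defs.
From mathcomp Require Import all_boot all_order all_algebra.
From mathcomp Require Import all_classical all_reals all_analysis.
From mathcomp Require Import lra.
Import Order.TTheory GRing.Theory Num.Theory.
Import numFieldNormedType.Exports.
Local Open Scope classical_set_scope.
Local Open Scope ring_scope.

(** * Syntax and countable models *)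

(** Decoding from a countable type of trees: surjectivity is enough for an enumeration of the
    syntax, so malformed trees may decode to anything. *)
Fixpoint term_of_tree (L : language) (t : GenTree.tree nat) : term L :=
  match t with
  | GenTree.Leaf n => Var L n
  | GenTree.Node k ts =>
      if unpickle k is Some f then
        App (f := f) (fun i => nth (Var L 0) (map (term_of_tree L) ts) i)
      else Var L 0
  end.

Fixpoint formula_of_tree (L : language) (t : GenTree.tree nat) : formula L :=
  match t with
  | GenTree.Node 0 [:: B; C] => And (formula_of_tree L B) (formula_of_tree L C)
  | GenTree.Node 1 [:: B; C] => Or (formula_of_tree L B) (formula_of_tree L C)
  | GenTree.Node 2 [:: B; C] => Imp (formula_of_tree L B) (formula_of_tree L C)
  | GenTree.Node 3 [:: GenTree.Leaf x; B] => All x (formula_of_tree L B)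
  | GenTree.Node 4 [:: GenTree.Leaf x; B] => Ex x (formula_of_tree L B)
  | GenTree.Node k.+4.+1 ts =>
      if unpickle k is Some p then
        Atom (p := p) (fun i => term_of_tree L (nth (GenTree.Leaf 0%N) ts i))
      else Bot L
  | _ => Bot L
  end.

Lemma nth_map_enum_ord {T T' : Type} {n : nat} (x0 : T') (f : T -> T')
    (g : 'I_n -> T) (i : 'I_n) :
  nth x0 (map f (map g (enum 'I_n))) i = f (g i).
Proof.
by rewrite -map_comp (nth_map i) ?size_enum_ord ?ltn_ord//= nth_ord_enum.
Qed.

Lemma term_of_tree_surj (L : language) (t : term L) :
  exists c, term_of_tree L c = t.
Proof.
elim: t => [n|f ts /choice[c cE]]; first by exists (GenTree.Leaf n).
exists (GenTree.Node (pickle f) (map c (enum 'I_(far f)))); rewrite /= pickleK.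
by congr App; apply/funext => i; rewrite nth_map_enum_ord cE.
Qed.

Lemma formula_of_tree_surj (L : language) (A : formula L) :
  exists c, formula_of_tree L c = A.
Proof.
elim: A => [|p ts|B [b <-] C [c <-]|B [b <-] C [c <-]|B [b <-] C [c <-]
           |x B [b <-]|x B [b <-]].
- by exists (GenTree.Leaf 0%N).
- have /choice[c cE] i := term_of_tree_surj L (ts i).
  exists (GenTree.Node (pickle p).+4.+1 (map c (enum 'I_(par p)))).
  rewrite /= pickleK; congr Atom; apply/funext => i; rewrite -cE.
  by rewrite (nth_map i) ?size_enum_ord// nth_ord_enum.
- by exists (GenTree.Node 0 [:: b; c]).
- by exists (GenTree.Node 1 [:: b; c]).
- by exists (GenTree.Node 2 [:: b; c]).
- by exists (GenTree.Node 3 [:: GenTree.Leaf x; b]).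
- by exists (GenTree.Node 4 [:: GenTree.Leaf x; b]).
Qed.

Lemma formula_enumeration (L : language) :
  exists E : nat -> formula L, forall A, exists n, E n = A.
Proof.
exists (fun n => formula_of_tree L (odflt (GenTree.Leaf 0%N) (unpickle n))).
move=> A; have [c <-] := formula_of_tree_surj L A.
by exists (pickle c); rewrite pickleK.
Qed.

Lemma teval_finite (R : realType) (L : language) (V : set R) (I : interp L V)
    (t : term L) :
  exists N, forall e e' : nat -> univ I,
    (forall x, (x < N)%N -> e x = e' x) -> teval e t = teval e' t.
Proof.
elim: t => [n|f ts /choice[N IH]].
  by exists n.+1 => e e' ee'; exact: ee'.
exists (\max_i N i)%N => e e' ee' /=; congr fval; apply/funext => i.
by apply: IH => x xN; apply: ee'; rewrite (leq_trans xN)// (leq_bigmax i).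
Qed.

(** Lets finite lists stand for assignments, so that Skolem functions take finitely many parameters
    and a countable universe yields countably many truth values. *)
Lemma feval_finite (R : realType) (L : language) (V : set R) (I : interp L V)
    (A : formula L) :
  exists N, forall e e' : nat -> univ I,
    (forall x, (x < N)%N -> e x = e' x) -> feval e A = feval e' A.
Proof.
have binary (op : R -> R -> R) (B C : formula L) :
    (exists N, forall e e' : nat -> univ I,
      (forall x, (x < N)%N -> e x = e' x) -> feval e B = feval e' B) ->
    (exists N, forall e e' : nat -> univ I,
      (forall x, (x < N)%N -> e x = e' x) -> feval e C = feval e' C) ->
    exists N, forall e e' : nat -> univ I,
      (forall x, (x < N)%N -> e x = e' x) ->
      op (feval e B) (feval e C) = op (feval e' B) (feval e' C).
  move=> [M IHB] [N IHC]; exists (maxn M N) => e e' ee'.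
  by congr op; [apply: IHB|apply: IHC] => x xN; apply: ee';
    rewrite leq_max xN ?orbT.
elim: A => [|p ts|B IHB C IHC|B IHB C IHC|B IHB C IHC|x B [N IH]|x B [N IH]].
- by exists 0%N.
- have /choice[N IH] i := teval_finite R L V I (ts i).
  exists (\max_i N i)%N => e e' ee' /=; congr pval; apply/funext => i.
  by apply: IH => x xN; apply: ee'; rewrite (leq_trans xN)// (leq_bigmax i).
- exact: binary.
- exact: binary.
- exact: (binary (fun b c => if b <= c then 1 else c)).
- exists N => e e' ee' /=; congr inf; apply: eq_imagel => u _.
  by apply: IH => y yN /=; case: eqP => // _; exact: ee'.
- exists N => e e' ee' /=; congr sup; apply: eq_imagel => u _.
  by apply: IH => y yN /=; case: eqP => // _; exact: ee'.
Qed.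

Lemma feval_itv01 {R : realType} {L : language} {V : set R} (I : interp L V) :
  V `<=` `[0, 1] -> forall (A : formula L) (e : nat -> univ I),
  0 <= feval e A <= 1.
Proof.
move=> V01 A.
elim: A => [|p ts|B IHB C IHC|B IHB C IHC|B IHB C IHC|x B IH|x B IH] e /=.
- by rewrite lexx ler01.
- by have /= := V01 _ (pvalP (fun i => teval e (ts i))); rewrite in_itv.
- by have := IHB e; have := IHC e; case: (leP (feval e B) (feval e C)).
- by have := IHB e; have := IHC e; case: (leP (feval e B) (feval e C)).
- by case: ifP => // _; rewrite lexx ler01.
- pose r := feval [eta e with x |-> vval I 0] B.
  have Br : range (fun u => feval [eta e with x |-> u] B) r.
    by exists (vval I 0).
  apply/andP; split.
    apply: lb_le_inf; first by exists r.
    by move=> _ [u _ <-]; case/andP: (IH [eta e with x |-> u]).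
  apply: (@le_trans _ _ r); last by case/andP: (IH [eta e with x |-> vval I 0]).
  apply: ge_inf => //; exists 0 => _ [u _ <-].
  by case/andP: (IH [eta e with x |-> u]).
- pose r := feval [eta e with x |-> vval I 0] B.
  have Br : range (fun u => feval [eta e with x |-> u] B) r.
    by exists (vval I 0).
  apply/andP; split; last first.
    apply: ge_sup; first by exists r.
    by move=> _ [u _ <-]; case/andP: (IH [eta e with x |-> u]).
  apply: (@le_trans _ _ r).
    by case/andP: (IH [eta e with x |-> vval I 0]).
  apply: ub_le_sup => //; exists 1 => _ [u _ <-].
  by case/andP: (IH [eta e with x |-> u]).
Qed.

(** Points approximating the infimum and the supremum within [1 / (n + 1)] are interleaved in [w].
    The arbitrary [g] will be the evaluation map of a Skolem hull. *)
Lemma inf_sup_attained_on_sequence {R : realType} {U : Type} (u0 : U)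
    (f : U -> R) :
  (forall u, 0 <= f u <= 1) ->
  exists w : nat -> U, forall (T : Type) (g : T -> U), range w `<=` range g ->
    inf (range (fun t => f (g t))) = inf (range f) /\
    sup (range (fun t => f (g t))) = sup (range f).
Proof.
move=> f01.
have f_ge0 u : 0 <= f u by case/andP: (f01 u).
have f_le1 u : f u <= 1 by case/andP: (f01 u).
have flb : has_inf (range f).
  by split; [exists (f u0); exists u0|exists 0 => _ [u _ <-]].
have fub : has_sup (range f).
  by split; [exists (f u0); exists u0|exists 1 => _ [u _ <-]].
have /choice[v vP] n : exists u, f u < inf (range f) + n.+1%:R^-1.
  have [|_ [u _ <-] uP] := @inf_adherent R (range f) n.+1%:R^-1 _ flb.
    by rewrite invr_gt0.
  by exists u.
have /choice[w wP] n : exists u, sup (range f) - n.+1%:R^-1 < f u.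
  have [|_ [u _ <-] uP] := @sup_adherent R (range f) n.+1%:R^-1 _ fub.
    by rewrite invr_gt0.
  by exists u.
exists (fun n => if odd n then v n./2 else w n./2) => T g vwg.
have vg n : exists t, g t = v n.
  have [|t _ <-] := vwg (v n); last by exists t.
  by exists n.*2.+1 => //=; rewrite odd_double uphalf_double.
have wg n : exists t, g t = w n.
  have [|t _ <-] := vwg (w n); last by exists t.
  by exists n.*2 => //=; rewrite odd_double doubleK.
have [t0 _] := wg 0%N.
split; apply/eqP; rewrite eq_le; apply/andP; split.
- apply/ler_addgt0Pr => e e0.
  have [n ne] : exists n, n.+1%:R^-1 < e.
    have [n _ /(_ n (leqnn n))] := near_infty_natSinv_lt (PosNum e0).
    by exists n.
  have [t gt] := vg n; apply: (@le_trans _ _ (f (g t))).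
    by apply: ge_inf; [exists 0 => _ [u _ <-]|exists t].
  by rewrite gt (le_trans (ltW (vP n)))// lerD2l ltW.
- apply: lb_le_inf; first by exists (f (g t0)); exists t0.
  by move=> _ [t _ <-]; apply: ge_inf; [case: flb|exists (g t)].
- apply: ge_sup; first by exists (f (g t0)); exists t0.
  by move=> _ [t _ <-]; apply: ub_le_sup; [case: fub|exists (g t)].
- apply/ler_addgt0Pr => e e0.
  have [n ne] : exists n, n.+1%:R^-1 < e.
    have [n _ /(_ n (leqnn n))] := near_infty_natSinv_lt (PosNum e0).
    by exists n.
  have [t gt] := wg n; rewrite -lerBlDr; apply: (@le_trans _ _ (f (g t))).
    by rewrite gt (le_trans _ (ltW (wP n)))// lerB// ltW.
  by apply: ub_le_sup; [exists 1 => _ [u _ <-]|exists t].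
Qed.

Lemma comp_with {T T' : Type} (h : T -> T') (e : nat -> T) (x : nat) (u : T) :
  (fun y => h ([eta e with x |-> u] y)) =
  [eta (fun y => h (e y)) with x |-> h u].
Proof. by apply/funext => y /=; case: eqP. Qed.

(** The Skolem hull is represented by its terms: the universe of [J] consists of trees over
    variables, function symbols and Skolem symbols, and [ev] maps them into [I]. Predicates are
    pulled back along [ev], whose range contains enough witnesses to preserve the quantifiers. *)
Lemma countable_model {R : realType} {L : language} {V : set R}
    (I : interp L V) :
  V `<=` `[0, 1] ->
  exists J : interp L V, (forall A, truth J A = truth I A) /\
    countable [set r | exists (e : nat -> univ J) A, r = feval e A].
Proof.
move=> V01; have [E Esurj] := formula_enumeration L.
pose u0 : univ I := vval I 0.
(* A Skolem function for the quantifier over [x] in the [n]-th formula, the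
   other variables taking the values listed in [s]. *)
have /choice[sk skP] : forall c : nat * nat * seq (univ I),
    exists w : nat -> univ I,
    forall (T : Type) (g : T -> univ I), range w `<=` range g ->
    let f u := feval [eta nth u0 c.2 with c.1.2 |-> u] (E c.1.1) in
    inf (range (fun t => f (g t))) = inf (range f) /\
    sup (range (fun t => f (g t))) = sup (range f).
  move=> c; apply: (inf_sup_attained_on_sequence u0) => u.
  exact: (feval_itv01 I V01).
(* The label [inr (n, x, k)] names the [k]-th Skolem witness for the variable [x] in the [n]-th
   formula; the subtrees supply the parameters. *)
pose op (k : Defs.fsym L + nat * nat * nat) (s : seq (univ I)) : univ I :=
  match k with
  | inl f => fval (fun i : 'I_(far f) => nth u0 s i)
  | inr c => sk (c.1, s) c.2
  end.
pose ev := fix ev (t : GenTree.tree nat) : univ I :=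
  match t with
  | GenTree.Leaf n => vval I n
  | GenTree.Node k ts =>
      if unpickle k is Some c then op c (map ev ts) else u0
  end.
pose J : interp L V := @Interp R L V (GenTree.tree nat)
  (fun p u => pval (fun i => ev (u i))) (fun p u => pvalP (fun i => ev (u i)))
  (fun f ts => GenTree.Node (pickle (inl f : Defs.fsym L + nat * nat * nat))
                            (map ts (enum 'I_(far f))))
  (fun n => GenTree.Leaf n).
have evNode c ts : ev (GenTree.Node (pickle c) ts) = op c (map ev ts).
  by rewrite /= pickleK.
have evJ (f : Defs.fsym L) (ts : 'I_(far f) -> univ J) :
    ev (fval ts) = fval (fun i => ev (ts i)).
  rewrite [LHS]evNode; congr fval; apply/funext => i.
  by rewrite nth_map_enum_ord.
have tevJ (e : nat -> univ J) t : ev (teval e t) = teval (fun n => ev (e n)) t.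
  elim: t => [//|f ts IH]; rewrite [LHS]evJ /=.
  by congr fval; apply/funext => i; exact: IH.
have skolem (e : nat -> univ J) x B :
    let f u := feval [eta (fun n => ev (e n)) with x |-> u] B in
    inf (range (fun t => f (ev t))) = inf (range f) /\
    sup (range (fun t => f (ev t))) = sup (range f).
  (* [B] sees only the first [N] values of [e]. Taken as subtrees of Skolem nodes, they put the
     whole Skolem sequence into the range of [ev]. *)
  have [N BN] := feval_finite R L V I B; have [n nB] := Esurj B.
  pose s := mkseq e N; move=> f.
  have -> : f = (fun u => feval [eta nth u0 (map ev s) with x |-> u] B).
    apply/funext => u; apply: BN => y yN /=; case: eqP => // _.
    by rewrite (nth_map (GenTree.Leaf 0%N)) ?size_mkseq// nth_mkseq.
  rewrite -nB; refine (skP (n, x, map ev s) _ ev _) => _ [k _ <-].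
  pose c : Defs.fsym L + nat * nat * nat := inr (n, x, k).
  by exists (GenTree.Node (pickle c) s); last exact: (evNode c).
have fevJ A : forall e : nat -> univ J, feval e A = feval (fun n => ev (e n)) A.
  elim: A => [|p ts|B IHB C IHC|B IHB C IHC|B IHB C IHC|x B IH|x B IH] e /=.
  - by [].
  - by congr pval; apply/funext => i; exact: tevJ.
  - by rewrite IHB IHC.
  - by rewrite IHB IHC.
  - by rewrite IHB IHC.
  - rewrite -(skolem e x B).1; congr inf; apply: eq_imagel => u _.
    by rewrite IH comp_with.
  - rewrite -(skolem e x B).2; congr sup; apply: eq_imagel => u _.
    by rewrite IH comp_with.
exists J; split; first by move=> A; rewrite /truth fevJ.
pose val (c : nat * seq (GenTree.tree nat)) : R :=
  @feval R L V J (nth (GenTree.Leaf 0%N) c.2) (E c.1).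
apply: (@sub_countable _ _ _ (range val)); last first.
  exact: (sub_countable (card_image_le _ _) (countableP _)).
apply: subset_card_le => _ [e [A ->]].
have [N AN] := feval_finite R L V J A; have [n nA] := Esurj A.
exists (n, mkseq e N) => //; rewrite /val /= nA; apply: AN => x xN.
by rewrite nth_mkseq.
Qed.

(** * Transport of truth values along a monotone map *)

(** Monotonicity gives one inequality; for the other, continuity controls [f] at a member of [S]
    close to [inf S]. *)
Lemma nondecreasing_continuous_inf {R : realType} (f : R -> R) (S : set R) :
  {homo f : x y / x <= y} -> has_inf S -> {for inf S, continuous f} ->
  inf (f @` S) = f (inf S).
Proof.
move=> f_nd Sinf fc; have [[s0 Ss0] Slb] := Sinf.
have lb : lbound (f @` S) (f (inf S)).
  by move=> _ [s Ss <-]; apply: f_nd; exact: ge_inf.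
have ne : f @` S !=set0 by exists (f s0); exists s0.
apply/eqP; rewrite eq_le lb_le_inf// andbT; apply/ler_addgt0Pr => e e0.
move/cvgrPdist_le : fc => /(_ e e0) /nbhs_ballP[d /= d0 dP].
have [s Ss sd] := inf_adherent d0 Sinf.
apply: (@le_trans _ _ (f s)).
  by apply: ge_inf; [exists (f (inf S))|exists s].
have : `|f (inf S) - f s| <= e.
  apply: dP; rewrite /ball /= distrC ger0_norm ?subr_ge0 ?ge_inf//.
  by rewrite ltrBlDl.
by rewrite distrC ler_distl => /andP[].
Qed.

Lemma nondecreasing_continuous_sup {R : realType} (f : R -> R) (S : set R) :
  {homo f : x y / x <= y} -> has_sup S -> {for sup S, continuous f} ->
  sup (f @` S) = f (sup S).
Proof.
move=> f_nd Ssup fc; have [[s0 Ss0] Sub] := Ssup.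
have ub : ubound (f @` S) (f (sup S)).
  by move=> _ [s Ss <-]; apply: f_nd; exact: ub_le_sup.
have ne : f @` S !=set0 by exists (f s0); exists s0.
apply/eqP; rewrite eq_le ge_sup//=; apply/ler_addgt0Pr => e e0.
move/cvgrPdist_le : fc => /(_ e e0) /nbhs_ballP[d /= d0 dP].
have [s Ss sd] := sup_adherent d0 Ssup.
rewrite -lerBlDr; apply: (@le_trans _ _ (f s)); last first.
  by apply: ub_le_sup; [exists (f (sup S))|exists s].
have : `|f (sup S) - f s| <= e.
  apply: dP; rewrite /ball /= ger0_norm ?subr_ge0 ?ub_le_sup//.
  by rewrite ltrBlDl -ltrBlDr.
by rewrite distrC ler_distl => /andP[].
Qed.

(* [f] need not be injective: the values it identifies must all go to [1],
   which is what an implication with a larger antecedent requires. *)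
Lemma truth_comp {R : realType} {L : language} {V W : set R} (I : interp L W)
    (f : R -> R) :
  W `<=` `[0, 1] -> {homo f : x y / x <= y} ->
  (forall x y, x < y -> f y <= f x -> f x = 1) ->
  f 0 = 0 -> f 1 = 1 -> (forall x, W x -> V (f x)) ->
  (forall (e : nat -> univ I) A, {for feval e A, continuous f}) ->
  exists J : interp L V, forall A, truth J A = f (truth I A).
Proof.
move=> W01 f_nd f_strict f0 f1 fWV fc.
pose J : interp L V := @Interp R L V (univ I) (fun p u => f (pval u))
  (fun p u => fWV _ (pvalP u)) (@fval R L W I) (vval I).
have tevJ (e : nat -> univ I) t : @teval R L V J e t = teval e t.
  by elim: t => [//|g ts IH] /=; congr fval; apply/funext.
have f_min : {morph f : x y / Num.min x y}.
  move=> x y; have [xy|/ltW yx] := leP x y.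
    by rewrite min_l// f_nd.
  by rewrite min_r// f_nd.
have f_max : {morph f : x y / Num.max x y}.
  move=> x y; have [xy|/ltW yx] := leP x y.
    by rewrite max_r// f_nd.
  by rewrite max_l// f_nd.
have binst (e : nat -> univ I) x A :
    has_inf (range (fun u => feval [eta e with x |-> u] A)) /\
    has_sup (range (fun u => feval [eta e with x |-> u] A)).
  have ne : range (fun u => feval [eta e with x |-> u] A) !=set0.
    by exists (feval [eta e with x |-> vval I 0] A); exists (vval I 0).
  split; split => //; [exists 0|exists 1] => _ [u _ <-];
    by case/andP: (feval_itv01 I W01 A [eta e with x |-> u]).
have fevJ A : forall e : nat -> univ I, @feval R L V J e A = f (feval e A).
  elim: A => [|p ts|B IHB C IHC|B IHB C IHC|B IHB C IHC|x B IH|x B IH] e /=.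
  - by rewrite f0.
  - by congr (f (pval _)); apply/funext => i; exact: tevJ.
  - by rewrite IHB IHC f_min.
  - by rewrite IHB IHC f_max.
  - rewrite IHB IHC; have [BC|CB] := leP (feval e B) (feval e C).
      by rewrite f_nd.
    by case: ifP => // /(f_strict _ _ CB).
  (* The infimum is itself the value of [All x B], so [fc] gives continuity exactly there. *)
  - have [bnd _] := binst e x B.
    rewrite -(nondecreasing_continuous_inf _ _ f_nd bnd (fc e (All x B))).
    rewrite image_comp; congr inf; apply: eq_imagel => u _; exact: IH.
  - have [_ bnd] := binst e x B.
    rewrite -(nondecreasing_continuous_sup _ _ f_nd bnd (fc e (Ex x B))).
    rewrite image_comp; congr sup; apply: eq_imagel => u _; exact: IH.
by exists J => A; rewrite /truth fevJ.
Qed.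

(** * Monotone maps into a perfect set *)

(** On each interval []-n, n[] a monotone function has countably many jumps. Every discontinuity is
    a jump: the one-sided limits exist and enclose [f x], so if they agreed [f] would be continuous
    at [x]. *)
Lemma nondecreasing_countable_discontinuities {R : realType} (f : R -> R) :
  {homo f : x y / x <= y} -> countable [set x | ~ {for x, continuous f}].
Proof.
move=> f_nd.
suff sub : [set x | ~ {for x, continuous f}] `<=` \bigcup_n
    [set x | x \in (`](- n%:R), n%:R[ : interval R) /\ discontinuity f x].
  apply: sub_countable (subset_card_le sub) _.
  apply: bigcup_countable => // n _.
  by apply: discontinuity_countable => x y _ _; exact: f_nd.
move=> x fx.
have lcv : cvg (f y @[y --> x^'-]).
  apply: nondecreasing_at_left_is_cvgr; apply: nearW => y.
    by move=> u v _ _; exact: f_nd.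
  exists (f x) => _ [z /= + <-].
  by rewrite in_itv => /andP[_ /ltW]; exact: f_nd.
have rcv : cvg (f y @[y --> x^'+]).
  apply: nondecreasing_at_right_is_cvgr; apply: nearW => y.
    by move=> u v _ _; exact: f_nd.
  exists (f x) => _ [z /= + <-].
  by rewrite in_itv => /andP[/ltW + _]; exact: f_nd.
have lle : lim (f y @[y --> x^'-]) <= f x.
  apply: limr_le => //; near=> y; apply: f_nd.
  by near: y; exact: nbhs_left_le.
have rge : f x <= lim (f y @[y --> x^'+]).
  apply: limr_ge => //; near=> y; apply: f_nd.
  by near: y; exact: nbhs_right_ge.
exists (Num.bound `|x|) => //=; split.
  by rewrite in_itv/= -ltr_norml archi_boundP.
split => //; apply/eqP => lr; apply: fx; apply/left_right_continuousP.
have lE : lim (f y @[y --> x^'-]) = f x.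
  by apply/eqP; rewrite eq_le lle lr.
by split; [rewrite -lE|rewrite -lE lr].
Unshelve. all: by end_near. Qed.

(** A countable set is Lebesgue null, whereas []a, b[] has positive measure. *)
Lemma countable_itv_avoid {R : realType} (C : set R) (a b : R) :
  countable C -> a < b -> exists2 x, a < x < b & ~ C x.
Proof.
move=> Cc ab; apply: contrapT => nex.
have abC : `]a, b[ `<=` C.
  move=> x /=; rewrite in_itv /= => xab; apply: contrapT => nCx.
  by apply: nex; exists x.
have : countable `]a, b[%classic.
  exact: sub_countable (subset_card_le abC) Cc.
move=> /countable_lebesgue_measure0; rewrite lebesgue_measure_itv/= lte_fin ab.
by move/eqP; rewrite -EFinB eqe subr_eq0 gt_eqF.
Qed.

Lemma closed_inf_mem {R : realType} (A : set R) :
  closed A -> has_inf A -> A (inf A).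
Proof.
move=> Acl Ainf; apply: Acl => U /nbhs_ballP[d /= d0 dU].
have [x Ax xd] := inf_adherent d0 Ainf.
exists x; split => //; apply: dU; rewrite /ball /= distrC.
by rewrite ger0_norm ?subr_ge0 ?ge_inf//; [rewrite ltrBlDl|case: Ainf].
Qed.

Lemma closed_sup_subset {R : realType} (A B : set R) :
  closed A -> B `<=` A -> has_sup B -> A (sup B).
Proof.
move=> Acl BA [B0 Bub]; apply: Acl.
exact: closureS BA _ (closure_sup B0 Bub).
Qed.

(** The invariant between neighbours in the dyadic scheme; [x < y] would be too weak, since the
    interval could be a gap of [P]. *)
Definition separated_in {R : realType} (P : set R) (x y : R) : Prop :=
  exists2 z, P z & x < z < y.

(** Since [z] is a limit point, [P] has two points [lo < hi] between [x] and [y]; since [lo] is one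
    too, there is a third below [hi]. The middle one of the three is [m]. *)
Lemma perfect_separated_dense {R : realType} (P : set R) (x y : R) :
  perfect_set P -> separated_in P x y ->
  exists2 m, P m & separated_in P x m /\ separated_in P m y.
Proof.
move=> [_ Plim] [z Pz xzy].
have itv_nbhs (a b c : R) : a < c < b -> nbhs c [set t | a < t < b].
  move=> acb; have -> : [set t | a < t < b] = `]a, b[%classic.
    by apply/seteqP; split => t /=; rewrite in_itv.
  exact: near_in_itvoo.
have [lo [hi [Plo Phi xlo lohi hiy]]] :
    exists lo hi, [/\ P lo, P hi, x < lo, lo < hi & hi < y].
  move: (Pz); rewrite -{1}Plim => /(_ _ (itv_nbhs x y z xzy))[t [tz Pt]].
  case/andP: xzy => xz zy /andP[xt ty].
  have [tltz|zltt|tEz] := ltgtP t z; [by exists t, z|by exists z, t|].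
  by rewrite tEz eqxx in tz.
have xlohi : x < lo < hi by rewrite xlo.
move: (Plo); rewrite -{1}Plim => /(_ _ (itv_nbhs x hi lo xlohi))[c [clo Pc]].
move=> /andP[xc chi]; have [cltlo|loltc|cElo] := ltgtP c lo.
- by exists lo => //; split; [exists c; rewrite ?xc|exists hi; rewrite ?lohi].
- exists c => //; split; first by exists lo; rewrite ?xlo.
  by exists hi; rewrite ?chi.
- by rewrite cElo eqxx in clo.
Qed.

(** [inf P] lies in [P] and is not isolated, and other points of [P] can approach it only from
    above. *)
Lemma perfect_inf_separated {R : realType} (P : set R) (y : R) :
  perfect_set P -> has_inf P -> inf P < y -> separated_in P (inf P) y.
Proof.
move=> [Pcl Plim] Pinf py.
have := closed_inf_mem P Pcl Pinf; rewrite -{1}Plim => /(_ [set t | t < y]).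
case=> [|z [zp Pz zy]]; first exact: lt_nbhsl.
by exists z => //; rewrite zy andbT lt_neqAle eq_sym zp ge_inf//; case: Pinf.
Qed.

(* The value at [k / 2 ^ n] of the map on the dyadic numbers of [0, 1] which
   sends 0 to [p] and 1 to [b], and places midpoints with [mid]. *)
Fixpoint dyadic {R : realType} (mid : R -> R -> R) (p b : R) (n k : nat) : R :=
  if n is n'.+1 then
    if odd k then mid (dyadic mid p b n' k./2) (dyadic mid p b n' k./2.+1)
    else dyadic mid p b n' k./2
  else if k is 0%N then p else b.

(** [G x] is the supremum of the dyadic values placed at or below [x]. Continuity at 0 is secured in
    advance, because 0 will be the image of [inf P] under every reparametrization. *)
Lemma perfect_embedding {R : realType} (P : set R) :
  perfect_set P -> P !=set0 -> P `<=` `[0, 1] ->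
  exists G : R -> R, [/\ {homo G : x y / x <= y},
    forall x, x <= 0 -> G x = inf P,
    forall x, P (G x),
    (forall x y, 0 <= x -> x < y -> y <= 1 -> G x < G y) &
    {for 0, continuous G}].
Proof.
move=> Pperf P0 P01; have [Pcl _] := Pperf.
have Plb : has_lbound P by exists 0 => x /P01 /=; rewrite in_itv => /andP[].
have Pinf : has_inf P by [].
set p := inf P; have Pp : P p by exact: closed_inf_mem.
(* The last clause makes midpoints next to [p] at least halve the distance to [p]; continuity at 0
   comes from it. *)
have /choice[mid1 midP1] : forall c : R * R, exists m, separated_in P c.1 c.2 ->
    [/\ P m, separated_in P c.1 m, separated_in P m c.2 &
      c.1 = p -> m - p <= (c.2 - p) / 2].
  move=> [x y] /=; have [xy|nxy] := pselect (separated_in P x y); last first.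
    by exists 0.
  have [xp|xNp] := eqVneq x p; last first.
    have [m Pm [xm my]] := perfect_separated_dense P x y Pperf xy.
    by exists m => _; split => // xp; rewrite xp eqxx in xNp.
  have py : p < y by rewrite -xp; case: xy => z _ /andP[]; exact: lt_trans.
  have [|m Pm [pm my]] := perfect_separated_dense P p (p + (y - p) / 2) Pperf.
    by apply: perfect_inf_separated => //; rewrite ltrDl divr_gt0// subr_gt0.
  exists m => _; rewrite xp; case: my => z Pz /andP[mz zy]; split => //.
    by exists z => //; rewrite mz/=; lra.
  by move=> _; lra.
pose mid x y := mid1 (x, y).
have midP x y : separated_in P x y ->
    [/\ P (mid x y), separated_in P x (mid x y), separated_in P (mid x y) y &
      x = p -> mid x y - p <= (y - p) / 2] by exact: midP1 (x, y).
have [b Pb pb] : exists2 b, P b & separated_in P p b.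
  have [|b1 Pb1 /andP[pb1 _]] := perfect_inf_separated P (p + 1) Pperf Pinf.
    by rewrite ltrDl.
  have [m Pm [pm _]] := perfect_separated_dense P p b1 Pperf
    (perfect_inf_separated P b1 Pperf Pinf pb1).
  by exists m.
pose d := dyadic mid p b.
have dS n k :
    d n.+1 k = if odd k then mid (d n k./2) (d n k./2.+1) else d n k./2.
  by [].
have d_sep n k : (k < 2 ^ n)%N -> separated_in P (d n k) (d n k.+1).
  elim: n k => [|n IH] k kn; first by case: k kn.
  rewrite !dS /=; have kn2 : (k./2 < 2 ^ n)%N.
    by rewrite expnS mul2n in kn; rewrite ltn_half_double.
  have [_ dm md _] := midP _ _ (IH _ kn2).
  by case ok: (odd k) => /=; rewrite uphalf_half ok.
have d_lt n j k : (k <= 2 ^ n)%N -> (j < k)%N -> d n j < d n k.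
  elim: k => // k IH kn; rewrite ltnS leq_eqVlt => /predU1P[->|jk].
    by have [z _ /andP[]] := d_sep _ _ kn; exact: lt_trans.
  apply: lt_trans (IH (ltnW kn) jk) _.
  by have [z _ /andP[]] := d_sep _ _ kn; exact: lt_trans.
have d_le n j k : (k <= 2 ^ n)%N -> (j <= k)%N -> d n j <= d n k.
  by move=> kn; rewrite leq_eqVlt => /predU1P[->//|jk]; exact/ltW/d_lt.
have dP n k : (k <= 2 ^ n)%N -> P (d n k).
  elim: n k => [|n IH] k kn; first by case: k kn => [|[]].
  rewrite dS; have kn2 : (k./2 <= 2 ^ n)%N.
    by rewrite expnS mul2n in kn; rewrite leq_half_double (leq_trans kn).
  case: (boolP (odd k)) => ok; last exact: IH.
  have kn3 : (k./2 < 2 ^ n)%N.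
    rewrite ltn_neqAle kn2 andbT; apply/eqP => kE.
    by move: kn; rewrite expnS mul2n -kE -{1}(odd_double_half k) ok add1n ltnn.
  by have [] := midP _ _ (d_sep _ _ kn3).
have d0 n : d n 0%N = p by elim: n => //= n; rewrite dS.
have d1 n : d n 1%N - p <= (b - p) / 2 ^+ n.
  elim: n => [|n IH]; first by rewrite expr0 divr1.
  rewrite dS /=; have := d_sep n 0%N; rewrite expn_gt0 => /(_ isT) /midP[_ _ _].
  rewrite d0 => /(_ erefl) /le_trans; apply.
  by rewrite exprSr invfM mulrA ler_pM2r.
have d_refine n m k : d (m + n)%N (k * 2 ^ m)%N = d n k.
  elim: m => [|m IH]; first by rewrite muln1.
  by rewrite addSn dS expnS mulnCA mul2n odd_double doubleK.
(* Values of different levels are compared at the common level [m + n]. *)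
have d_cross m j n k : (k <= 2 ^ n)%N -> (j * 2 ^ n <= k * 2 ^ m)%N ->
    d m j <= d n k.
  move=> kn jk; rewrite -(d_refine m n j) -(d_refine n m k) (addnC m).
  by apply: d_le => //; rewrite expnD leq_mul2r kn orbT.
(* Admitting [k = 0] for every [x] keeps the set nonempty and gives [G] the value [p] at negative
   arguments. *)
pose below (x : R) := [set r | exists n k, [/\ (k <= 2 ^ n)%N,
  k = 0%N \/ k%:R <= x * 2 ^+ n & r = d n k]].
have below_p x : below x p by exists 0%N, 0%N; split => //; left.
have below_P x : below x `<=` P by move=> _ [n [k [kn _ ->]]]; exact: dP.
have below_sup x : has_sup (below x).
  split; first by exists p.
  by exists 1 => r /below_P /P01 /=; rewrite in_itv => /andP[].
pose G (x : R) := sup (below x).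
have d_G x n k : (k <= 2 ^ n)%N -> k%:R <= x * 2 ^+ n -> d n k <= G x.
  move=> kn kx; apply: ub_le_sup; first by case: (below_sup x).
  by exists n, k; split => //; right.
have G_d x n k : (k <= 2 ^ n)%N -> x * 2 ^+ n <= k%:R -> G x <= d n k.
  move=> kn xk; apply: ge_sup; first by exists p.
  move=> _ [m [j [jm + ->]]] => -[->|jx].
    by rewrite d0 -(d0 n); exact: d_le.
  apply: d_cross => //; rewrite -(ler_nat R) !natrM !natrX.
  have e2 i : 0 < 2 ^+ i :> R by rewrite exprn_gt0.
  apply: (@le_trans _ _ (x * 2 ^+ m * 2 ^+ n)); first by rewrite ler_pM2r.
  by rewrite mulrAC ler_pM2r.
have G_le0 x : x <= 0 -> G x = p.
  move=> x0; apply/eqP; rewrite eq_le; apply/andP; split.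
    by apply: (G_d x 0%N 0%N) => //; rewrite expr0 mulr1.
  by apply: ub_le_sup; [case: (below_sup x)|].
have G_nd : {homo G : x y / x <= y}.
  move=> x y xy; apply: ge_sup; first by exists p.
  move=> _ [n [k [kn + ->]]] => -[->|kx]; last first.
    by apply: d_G => //; rewrite (le_trans kx)// ler_pM2r// exprn_gt0.
  by rewrite d0; apply: ub_le_sup; [case: (below_sup y)|].
exists G; split => //.
- by move=> x; exact: closed_sup_subset (below_P x) (below_sup x).
- move=> x y x0 xy y1.
  (* With a mesh below half of [y - x], and [t] the integer part of [x * 2 ^+ n], the dyadics with
     numerators [t.+1] and [t.+2] both lie between [x] and [y]. *)
  have [n] : exists n, 2 < (y - x) * 2 ^+ n.
    exists (Num.bound (2 / (y - x))); rewrite -ltr_pdivrMl ?subr_gt0// mulrC.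
    have /archi_boundP/lt_trans -> // : 0 <= 2 / (y - x).
      by rewrite divr_ge0// subr_ge0 ltW.
    by rewrite -natrX ltr_nat ltn_expl.
  rewrite mulrBl => nP; have xn0 : 0 <= x * 2 ^+ n.
    by rewrite mulr_ge0// exprn_ge0.
  have /andP[] := truncn_itv xn0; move: (Num.truncn _) => t tx /ltW xk.
  have ky : t.+2%:R <= y * 2 ^+ n.
    have -> : t.+2%:R = t%:R + 2 :> R by rewrite -(addn2 t) natrD.
    by lra.
  have kn : (t.+2 <= 2 ^ n)%N.
    rewrite -(ler_nat R) natrX (le_trans ky)// ler_piMl// exprn_ge0//.
  apply: le_lt_trans (G_d x n t.+1 (ltnW kn) xk) _.
  by apply: lt_le_trans (d_G y n t.+2 kn ky); exact: d_lt.
- apply/cvgrPdist_le => e e0.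
  have [n nP] : exists n, (b - p) / 2 ^+ n <= e.
    exists (Num.bound ((b - p) / e)); rewrite ler_pdivrMr ?exprn_gt0//.
    rewrite mulrC -ler_pdivrMr//.
    have /archi_boundP/ltW/le_trans -> // : 0 <= (b - p) / e.
      by rewrite divr_ge0 ?(ltW e0)// subr_ge0 ge_inf.
    by rewrite -natrX ler_nat ltnW// ltn_expl.
  have n0 : 0 < (2 ^+ n)^-1 :> R by rewrite invr_gt0 exprn_gt0.
  near=> x; rewrite G_le0// ler_distlC; apply/andP; split.
    rewrite (@le_trans _ _ p)//; first by rewrite lerBlDr lerDl ltW.
    by apply: ub_le_sup; [case: (below_sup x)|].
  rewrite (@le_trans _ _ (d n 1%N))//; last first.
    by rewrite -lerBlDl (le_trans (d1 n)).
  apply: G_d; first by rewrite expn_gt0.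
  rewrite -ler_pdivlMr ?exprn_gt0// mul1r.
  by apply: ltW; near: x; exact: (lt_nbhsl n0).
Unshelve. all: by end_near. Qed.

(* Values above the cut [w] are sent to [1], and values between [inf P] and [w]
   are moved into [P]; the generic choice of [w] keeps both the cut and the
   jumps of the embedding away from [M]. *)
Lemma collapse_into_perfect {R : realType} (P M : set R) (a b : R) :
  perfect_set P -> P !=set0 -> P `<=` `[0, 1] -> countable M ->
  a < b -> b <= 1 ->
  exists f : R -> R, [/\ {homo f : x y / x <= y},
    (forall x y, x < y -> f y <= f x -> f x = 1),
    (forall x, (x <= inf P -> f x = x) /\ (inf P <= x -> P (f x)) \/ f x = 1),
    f a < 1 /\ f b = 1 &
    forall x, M x -> {for x, continuous f}].
Proof.
move=> Pperf P0 P01 Mc ab b1; set p := inf P.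
have Plb : has_lbound P by exists 0 => x /P01 /=; rewrite in_itv => /andP[].
have Pinf : has_inf P by [].
have P_le1 x : P x -> x <= 1 by move/P01 => /=; rewrite in_itv => /andP[].
(* [H] is replaced by 1 from [w] on. As [w] is not in [M], near each point of [M] the result is
   constantly 1 or equal to [H]; strictness up to [w] keeps the values before [w] below 1. *)
suff [w [aw wb wM [H [H_nd H_lt Hw1 HP Hc]]]] :
    exists w, [/\ a < w, w < b, ~ M w &
    exists H : R -> R, [/\ {homo H : x y / x <= y},
      (forall x y, x < y -> y <= w -> H x < H y),
      H w <= 1,
      (forall x, x < w -> (x <= p -> H x = x) /\ (p <= x -> P (H x))) &
      forall x, M x -> {for x, continuous H}]].
  pose f x := if w <= x then 1 else H x; exists f; split.
  - move=> x y xy; rewrite /f; case: (leP w x) => [wx|xw].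
      by rewrite (le_trans wx xy).
    by case: ifP => _; [exact: le_trans (H_nd _ _ (ltW xw)) Hw1|exact: H_nd].
  - move=> x y xy; rewrite /f; case: (leP w x) => // xw.
    case: (leP w y) => [wy|yw]; first by have := H_lt _ _ xw (lexx w); lra.
    by have := H_lt _ _ xy (ltW yw); lra.
  - by move=> x; rewrite /f; case: (leP w x) => xw; [right|left; exact: HP].
  - rewrite /f; split; last by rewrite (ltW wb).
    by rewrite leNgt aw/=; exact: lt_le_trans (H_lt _ _ aw (lexx w)) Hw1.
  - move=> x Mx; have [wx|xw|wx] := ltgtP w x; last by rewrite wx in wM.
    + have E : \forall y \near x, 1 = f y.
        near=> y; rewrite /f ifT// ltW//.
        by near: y; exact: lt_nbhsr.
      apply: cvg_trans (near_eq_cvg E) _.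
      by rewrite /f ltW//; exact: cvg_cst.
    + have E : \forall y \near x, H y = f y.
        near=> y; rewrite /f ifF//; apply/negbTE; rewrite -ltNge.
        by near: y; exact: lt_nbhsl.
      apply: cvg_trans (near_eq_cvg E) _.
      by rewrite /f leNgt xw; exact: Hc.
(* If [b <= p], the cut falls below [P] and the identity serves as [H]. *)
have [bp|pb] := leP b p.
  have [w /andP[aw wb] wM] := countable_itv_avoid M a b Mc ab.
  exists w; split => //; exists id; split => //.
  - by rewrite (le_trans (ltW wb)).
  - by move=> x xw; split => // px; lra.
  - by move=> x _; exact: cvg_id.
have [G [G_nd G_le0 GP G_lt G_cont0]] := perfect_embedding P Pperf P0 P01.
(* [q] below sends [x] to a jump [y] of [G] only for [w = p + (x - p) / y], which excludes countably
   many [w]. The point [x = p] always goes to 0, where [G] is continuous. *)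
pose bad := [set p + (c.1 - p) / c.2 |
  c in M `*` [set x | ~ {for x, continuous G}]].
have bad_countable : countable (M `|` bad).
  rewrite -bigcup2E; apply: bigcup_countable => // -[|[|i]] _ //=.
  apply: sub_countable (card_image_le _ _) _.
  by apply: countableX => //; exact: nondecreasing_countable_discontinuities.
have [|w /andP[]] := countable_itv_avoid _ (Num.max a p) b bad_countable.
  by rewrite gt_max ab pb.
rewrite gt_max => /andP[aw pw] wb wbad; exists w; split => //.
  by move=> Mw; apply: wbad; left.
have wp0 : 0 < w - p by rewrite subr_gt0.
pose q x := (x - p) / (w - p).
have q_lt x y : x < y -> q x < q y.
  by move=> xy; rewrite ltr_pM2r ?invr_gt0// ltrD2r.
have q_nd : {homo q : x y / x <= y}.
  by move=> x y xy; rewrite ler_pM2r ?invr_gt0// lerD2r.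
have qp : q p = 0 by rewrite /q subrr mul0r.
have qw : q w = 1 by rewrite /q divff// gt_eqF.
(* One formula for the identity up to [p] and [G] after [q] beyond it, so continuity at [p] requires
   no gluing. *)
pose H x := Num.min x p + G (q x) - p.
have H_le x : x <= p -> H x = x.
  by move=> xp; rewrite /H min_l// G_le0 ?addrK// -qp q_nd.
have H_ge x : p <= x -> H x = G (q x).
  by move=> px; rewrite /H min_r// addrC addKr.
exists H; split.
- by move=> x y xy; rewrite lerD2r lerD//; [exact: le_min2|exact/G_nd/q_nd].
- move=> x y xy yw; have [xp|px] := ltP x p.
    rewrite ltrD2r ltr_leD//; last by apply: G_nd; apply: q_nd; exact: ltW.
    by rewrite min_l ?(ltW xp)// lt_min xy.
  rewrite !H_ge ?(le_trans px (ltW xy))//; apply: G_lt.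
  - by rewrite -qp q_nd.
  - exact: q_lt.
  - by rewrite -qw q_nd.
- by rewrite H_ge ?(ltW pw)//; exact: P_le1.
- by move=> x _; split=> [/H_le//|/H_ge ->]; exact: GP.
move=> x Mx.
have qc : {for x, continuous q}.
  by apply: cvgM; [apply: cvgB; [exact: cvg_id|exact: cvg_cst]|exact: cvg_cst].
have Gc : {for q x, continuous G}.
  apply: contrapT => Gnc; apply: wbad; right; exists (x, q x) => //=.
  have xp0 : x - p != 0.
    by apply/eqP => xp; apply: Gnc; rewrite /q xp mul0r.
  by rewrite /q invfM invrK mulrA mulfV// mul1r subrKC.
apply: cvgB; last exact: cvg_cst.
apply: cvgD; last exact: (continuous_comp qc Gc).
by apply: (@continuous_min R R id (fun=> p) x); [exact: cvg_id|exact: cvg_cst].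
Unshelve. all: by end_near. Qed.

(** * Comparison of the entailment relations *)

Lemma perfect_kernel_sub {R : realType} (V P : set R) :
  perfect_kernel V P -> P `<=` V.
Proof. by move=> [_ [C [_ _ ->]]]; exact: subsetUl. Qed.

(** Interpretations over [V] and [W] have different types; [truth_comp] with the identity turns the
    former into the latter. *)
Lemma entails_sub {R : realType} {L : language} (V W : set R)
    (G : set (formula L)) (A : formula L) :
  V `<=` `[0, 1] -> V `<=` W -> entails W G A -> entails V G A.
Proof.
move=> V01 VW WGA I.
have [//|x y xy|//|//|//|e B|J JI] := @truth_comp R L W V I id V01.
- by rewrite leNgt xy.
- exact: cvg_id.
rewrite -(JI A) /truth_set; have -> : truth I @` G = truth J @` G.
  by apply: eq_imagel => B _; rewrite JI.
exact: WGA.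
Qed.

(** The empty set of premises has truth value 1, the largest possible one, so equality of logics is
    a case of equality of entailments. *)
Lemma godel_logic_entails (R : realType) (L : language) (V : set R) :
  V `<=` `[0, 1] -> godel_logic L V = [set A | entails V set0 A].
Proof.
move=> V01; apply/seteqP; split => A /= VA I.
  by rewrite /truth_set image_set0 setU0 inf1 VA.
have := VA I; rewrite /truth_set image_set0 setU0 inf1 => A1.
by apply/eqP; rewrite eq_le A1 andbT; case/andP: (feval_itv01 I V01 A (vval I)).
Qed.

Theorem theorem33 (R : realType) (L : language) (V P : set R)
    (godelV : godel_set V) (kernelP : perfect_kernel V P) (P0 : P !=set0) :
  let W := V `|` `[inf P, 1] in
  (forall (G : set (formula L)) (A : formula L),
     entails V G A <-> entails W G A) /\
  godel_logic L V = godel_logic L W.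
Proof.
move=> W; have [_ V01 V0 V1] := godelV.
have PV := perfect_kernel_sub _ _ kernelP; have [Pperf _] := kernelP.
have P01 : P `<=` `[0, 1] by exact: subset_trans V01.
have p_ge0 : 0 <= inf P.
  by apply: lb_le_inf => // x /P01 /=; rewrite in_itv => /andP[].
have W01 : W `<=` `[0, 1].
  move=> x [/V01//|] /=; rewrite !in_itv /= => /andP[px ->].
  by rewrite (le_trans p_ge0 px).
have entVW G A : entails V G A <-> entails W G A.
  split; last by apply: entails_sub => //; exact: subsetUl.
  move=> VGA I; rewrite leNgt; apply/negP => AG.
  have [J [JI Jc]] := countable_model I W01.
  have truth01 B : 0 <= truth I B <= 1 by exact: feval_itv01.
  have GI_lb : has_lbound ([set 1] `|` truth I @` G).
    by exists 0 => _ [->//|[B _ <-]]; case/andP: (truth01 B).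
  have GI_le1 : truth_set I G <= 1 by apply: ge_inf => //; left.
  have [f [f_nd f_strict fP [fA fG] fc]] :=
    collapse_into_perfect P _ _ _ Pperf P0 P01 Jc AG GI_le1.
  have f1 : f 1 = 1.
    have := f_nd _ _ GI_le1; rewrite fG => f1_ge1.
    have [[_ Pf1]|//] := fP 1.
    apply/eqP; rewrite eq_le f1_ge1 andbT.
    have /Pf1/P01 : inf P <= 1.
      case: P0 => x Px; apply: (@le_trans _ _ x); last first.
        by have /= := P01 x Px; rewrite in_itv => /andP[].
      apply: ge_inf => //; exists 0 => y /P01 /=.
      by rewrite in_itv => /andP[].
    by rewrite /= in_itv => /andP[].
  have f0 : f 0 = 0.
    (* If [f 0] were 1, monotonicity would force [f] to be at least 1 at [truth I A]. *)
    have [[/(_ p_ge0)//]|f0] := fP 0.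
    have /andP[/f_nd + _] := truth01 A.
    by rewrite f0 leNgt fA.
  (* Values from [inf P] on go into [P] or to 1; a smaller one is fixed or sent to 1, and it already
     belongs to [V]. *)
  have fWV x : W x -> V (f x).
    move=> Wx; have [[fid fPx]|->//] := fP x.
    have [px|xp] := leP (inf P) x; first by apply/PV/fPx.
    rewrite fid ?(ltW xp)//; case: Wx => //=.
    by rewrite in_itv /= leNgt xp.
  have [K KJ] := truth_comp J f W01 f_nd f_strict f0 f1 fWV
    (fun e B => fc _ (ex_intro _ e (ex_intro _ B erefl))).
  have : truth_set K G <= truth K A by exact: VGA.
  rewrite KJ JI leNgt => /negP; apply; apply: (lt_le_trans fA).
  (* Each premise has value at least [truth_set I G] in [I], which [f] sends to 1. *)
  apply: lb_le_inf; first by exists 1; left.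
  move=> _ [->//|[B GB <-]]; rewrite KJ JI -fG; apply: f_nd.
  by apply: ge_inf => //; right; exists B.
split => //; rewrite !godel_logic_entails//.
by apply/seteqP; split => A; apply entVW.
Qed.
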